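(* Let $\mathbb{F}$ be an algebraically closed field of characteristic $p \neq 2,3$. Let $A$ be a $1$-perfect finite dimensional associative algebra over $\mathbb{F}$, let $A' \subseteq A$ be a subalgebra, and let $B'$ be a bar-minimal Jordan-Lie inner ideal of $A'$ (that is, of the Lie algebra $A'^{(-)}$). Then: (1) there is a bar-minimal Jordan-Lie inner ideal $B$ of $A$ (that is, of the Lie algebra $A^{(-)}$) such that $B' \subseteq B$; (2) there is a regular inner ideal $B$ of $A$ (that is, of the Lie algebra $A^{(-)}$) such that $B' \subseteq B$.
   Context: Associative algebras are not required to have an identity element, and subalgebras are not required to contain an identity of the larger algebra. Characteristic $p$ may be $0$. An associative algebra is $1$-perfect if it has no (two-sided) ideals of codimension $1$. For an associative algebra $C$, $C^{(-)}$ denotes the Lie algebra on the vector space $C$ with bracket $[x,y]=xy-yx$. An inner ideal of a Lie algebra $L$ is a subspace $B$ with $[B,[B,L]] \subseteq B$. For $L = C^{(-)}$, an inner ideal $B$ of $L$ is Jordan-Lie if $B^2=0$, where $B^2$ is the span of the associative products $bb'$ with $b,b' \in B$. It is regular if $B^2=0$ and $BCB \subseteq B$, where $BCB$ is the span of the products $bcb'$ with $b,b'\in B$, $c\in C$. Let $C$ be a finite dimensional associative algebra with (nilpotent) radical $\operatorname{rad} C$, and let $L=C^{(-)}$. For a subspace $B \subseteq L$ let $\bar B$ be its image in $L/(L\cap \operatorname{rad} C)$. An inner ideal $B$ of $L$ is bar-minimal if every inner ideal $B_1$ of $L$ with $B_1 \subseteq B$ and $\bar B_1 = \bar B$ satisfies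 $B_1 = B$. For a subalgebra $A'$ of $A$, bar-minimality in $A'$ is taken with respect to $\operatorname{rad} A'$. *)

(* Defs.v *)
From Stdlib Require Import ClassicalEpsilon.
From HB Require Import structures.
From mathcomp Require Import all_boot all_order all_algebra.

Set Implicit Arguments.
Unset Strict Implicit.
Unset Printing Implicit Defensive.

Import GRing.Theory.
Local Open Scope ring_scope.

(* A finite dimensional, not necessarily unital, associative algebra over F is
   a space A : vectType F with mul : {bilinear A -> A -> A} and
   associative mul.  All notions below are relative to a subalgebra C of A,
   given as a subspace; the algebra A itself is the case C = fullv. *)

Section Subspaces.
Variables (F : fieldType) (A : vectType F).
Implicit Types (f : {bilinear A -> A -> A}) (U V W : {vspace A}).

(* The span of all f u v with u in U and v in V (see spanopP); same encoding
   as falgebra.prodv, which is only available for unital algebras. *)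
Definition spanop f U V : {vspace A} :=
  <<[seq f u v | u <- vbasis U, v <- vbasis V]>>%VS.

Lemma memv_spanop f U V u v : u \in U -> v \in V -> f u v \in spanop f U V.
Proof.
move=> /coord_vbasis-> /coord_vbasis->.
rewrite linear_sumr; apply: memv_suml => j _.
rewrite linear_sumlz; apply: memv_suml => i _.
rewrite linearZr_LR linearZl_LR /= !memvZ // memv_span //.
by apply/allpairsP; exists ((vbasis U)`_i, (vbasis V)`_j); rewrite !memt_nth.
Qed.

Lemma spanopP f U V W :
  reflect {in U & V, forall u v, f u v \in W} (spanop f U V <= W)%VS.
Proof.
apply: (iffP idP) => [sUVW u v Uu Vv | sUVW].
  by rewrite (subvP sUVW) ?memv_spanop.
by apply/span_subvP=> _ /allpairsP[[u v] /= [Uu Vv ->]]; rewrite sUVW ?vbasis_mem.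
Qed.

Lemma spanopS f U U' V V' :
  (U <= U')%VS -> (V <= V')%VS -> (spanop f U V <= spanop f U' V')%VS.
Proof.
by move=> /subvP sU /subvP sV; apply/spanopP=> u v /sU ? /sV ?; apply: memv_spanop.
Qed.

Definition commutator f (x y : A) : A := f x y - f y x.

Fact commutator_is_bilinear f : bilinear_for *:%R *:%R (commutator f).
Proof.
split=> x a u v; rewrite /applyr /commutator !linearPl !linearPr /=;
  by rewrite scalerBr addrACA opprD.
Qed.
HB.instance Definition _ f := bilinear_isBilinear.Build F A A A
  _ _ (commutator f) (commutator_is_bilinear f).

End Subspaces.

(* f is the Lie bracket and L the Lie algebra, a subspace of A closed under f. *)
Definition inner_ideal (F : fieldType) (A : vectType F)
    (f : {bilinear A -> A -> A}) (L B : {vspace A}) : Prop :=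
  (B <= L)%VS /\ (spanop f B (spanop f B L) <= B)%VS.

Section AssociativeAlgebra.
Variables (F : fieldType) (A : vectType F) (mul : {bilinear A -> A -> A}).
Implicit Types B C I R U : {vspace A}.

Definition subalgebra C : Prop := (spanop mul C C <= C)%VS.

Definition ideal C I : Prop :=
  [/\ (I <= C)%VS, (spanop mul C I <= I)%VS & (spanop mul I C <= I)%VS].

Definition one_perfect C : Prop := forall I, ideal C I -> \dim C <> (\dim I).+1.

(* powv U n is U^(n+1). *)
Fixpoint powv U n := if n is n'.+1 then spanop mul (powv U n') U else U.

Definition nilpotent U : Prop := exists n, powv U n = 0%VS.

Definition is_radical C R : Prop :=
  [/\ ideal C R, nilpotent R
    & forall I, ideal C I -> nilpotent I -> (I <= R)%VS].

(* The largest nilpotent ideal of C; it exists by radP below. *)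
Definition rad C : {vspace A} := epsilon (inhabits 0%VS) (is_radical C).

Lemma spanopA U V W (mulA : associative mul) :
  (spanop mul (spanop mul U V) W <= spanop mul U (spanop mul V W))%VS.
Proof.
apply/spanopP=> x w Ux Ww; set X := spanop _ U _.
suff /subvP/(_ x Ux): (spanop mul U V <= linfun (applyr mul w) @^-1: X)%VS.
  by rewrite -memv_preim lfunE.
apply/spanopP=> u v Uu Vv; rewrite -memv_preim lfunE /=.
by rewrite -mulA !memv_spanop.
Qed.

Lemma powvD U m n (mulA : associative mul) :
  (powv U (m + n).+1%N <= spanop mul (powv U m) (powv U n))%VS.
Proof.
elim: n => [|n IHn]; first by rewrite addn0.
rewrite addnS /=; apply: subv_trans (spanopA _ _ _ mulA).
exact: spanopS IHn _.
Qed.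

Lemma ideal_powv C I n : ideal C I -> (powv I n <= I)%VS.
Proof.
case=> IC _ IIC; elim: n => //= n IHn.
by apply: subv_trans IIC; apply: spanopS.
Qed.

Lemma idealD C I J : ideal C I -> ideal C J -> ideal C (I + J)%VS.
Proof.
move=> [IC CI IIC] [JC CJ JJC]; split; first by rewrite subv_add IC JC.
- apply/spanopP=> c _ Cc /memv_addP[x Ix [y Jy ->]].
  by rewrite linearDr memv_add ?(spanopP _ _ _ _ CI) ?(spanopP _ _ _ _ CJ).
- apply/spanopP=> _ c /memv_addP[x Ix [y Jy ->]] Cc.
  by rewrite linearDl memv_add ?(spanopP _ _ _ _ IIC) ?(spanopP _ _ _ _ JJC).
Qed.

Lemma nilpotentD C I J (mulA : associative mul) :
  ideal C I -> ideal C J -> nilpotent I -> nilpotent J -> nilpotent (I + J)%VS.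
Proof.
move=> idI idJ [n In0] [m Jm0]; have [JC CJ JJC] := idJ.
have [IJC _ _] := idealD idI idJ; have [IC _ IIC] := idI.
have sIJ k : (powv (I + J)%VS k <= powv I k + J)%VS.
  elim: k => //= k IHk; apply: (@subv_trans _ _ (spanop mul (powv I k + J)%VS (I + J)%VS)).
    exact: spanopS.
  apply/spanopP=> _ _ /memv_addP[x Ix [y Jy ->]] /memv_addP[x' Ix' [y' Jy' ->]].
  rewrite linearDl linearDr /= -addrA memv_add ?memv_spanop //.
  apply: memvD; [apply: (spanopP _ _ _ _ CJ) | apply: (spanopP _ _ _ _ JJC)] => //.
    exact: subvP (subv_trans (ideal_powv k idI) IC) _ Ix.
  by rewrite (subvP IJC) ?memv_add.
have [k le_k]: exists k, (powv (I + J)%VS k <= powv J m)%VS.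
  elim: m {Jm0} => [|m [k IHk]].
    by exists n; have := sIJ n; rewrite In0 add0v.
  exists (k + n).+1%N; apply: subv_trans (powvD _ _ _ mulA) _.
  by apply: spanopS => //; have := sIJ n; rewrite In0 add0v.
by exists k; apply/eqP; rewrite -subv0 -Jm0.
Qed.

Lemma radical_exists C (mulA : associative mul) : exists R, is_radical C R.
Proof.
pose P (n : nat) := exists I, [/\ ideal C I, nilpotent I & \dim I = n].
pose p (n : nat) : bool := if excluded_middle_informative (P n) then true else false.
have pP n : reflect (P n) (p n).
  by rewrite /p; case: excluded_middle_informative => Pn; constructor.
have exp: exists n, p n.
  exists 0%N; apply/pP; exists 0%VS; rewrite dimv0; split=> //; last by exists 0%N.
  split; rewrite ?sub0v //; apply/spanopP => u v.
    by move=> _ /[!memv0] /eqP->; rewrite linear0r.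
  by move=> /[!memv0] /eqP-> _; rewrite linear0l.
have ubp n : p n -> (n <= \dim C)%N by case/pP=> I [[IC _ _] _ <-]; apply: dimvS.
case: (ex_maxnP exp ubp) => n /pP[R [idR nR <-]] maxR.
exists R; split=> // I idI nI.
suff /eqP->: R == (I + R)%VS by apply: addvSl.
rewrite eqEdim addvSr; apply/maxR/pP; exists (I + R)%VS; split=> //.
  exact: idealD.
exact: nilpotentD idI idR nI nR.
Qed.

Lemma radP C (mulA : associative mul) : is_radical C (rad C).
Proof. exact: epsilon_spec (radical_exists C mulA). Qed.

(* The inner ideals of C^(-) lie in C and rad C <= C, so their images in
   C / rad C can be taken in A / rad C. *)
Definition bar C B : Quotient.quot (rad C) -> Prop :=
  fun q => exists2 b, b \in B & q = (\pi b)%qT.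

(* Equal images in the quotient <=> equal full preimages. *)
Lemma bar_eqP C B1 B :
  (forall q : Quotient.quot (rad C), bar B1 q <-> bar B q) <->
  (B1 + rad C = B + rad C)%VS.
Proof.
have half U V : (forall q : Quotient.quot (rad C), bar U q -> bar V q) <->
    (U <= V + rad C)%VS.
  split=> [sUV | /subvP sUV _ [u /sUV/memv_addP[v Vv [r Rr ->]] ->]].
    apply/subvP=> u Uu; have [|v Vv /eqmodP] := sUV (\pi u)%qT; first by exists u.
    rewrite /= Quotient.equivE => uv.
    by rewrite -(subrK v u) addrC memv_add.
  by exists v => //; apply/eqmodP; rewrite /= Quotient.equivE addrAC subrr add0r.
split=> [eqB | eqB q].
  apply/eqP; rewrite eqEsubv !subv_add !addvSr !andbT.
  by apply/andP; split; apply/half=> q /eqB.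
have [_ h1] := half B1 B; have [_ h2] := half B B1.
by split; [apply: h1; rewrite -eqB | apply: h2; rewrite eqB]; apply: addvSl.
Qed.

Definition inner C B : Prop := inner_ideal (commutator mul) C B.

Definition jordan_lie C B : Prop := inner C B /\ spanop mul B B = 0%VS.

Definition regular_inner C B : Prop :=
  [/\ inner C B, spanop mul B B = 0%VS
    & (spanop mul (spanop mul B C) B <= B)%VS].

Definition bar_minimal C B : Prop :=
  inner C B /\
  forall B1, inner C B1 -> (B1 <= B)%VS ->
    (forall q : Quotient.quot (rad C), bar B1 q <-> bar B q) -> B1 = B.

End AssociativeAlgebra.

(* Main.v *)
From Stdlib Require Import Classical.
Require Import Defs.
From HB Require Import structures.
From mathcomp Require Import all_boot all_order all_algebra falgebra.

Set Implicit Arguments.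
Unset Strict Implicit.
Unset Printing Implicit Defensive.

Import GRing.Theory.
Local Open Scope ring_scope.

(* Let B be a Jordan-Lie inner ideal of an algebra C with radical R.  As B^2 = 0
   and the characteristic is not 2, b C b <= B for all b in B.  The algebra C is
   von Neumann regular modulo R, and if b x b = b modulo R then Fitting's lemma
   for b x provides an honestly regular element of b C b congruent to b.
   Consider the pairs of idempotents (e, f) of C with e C f <= B that are linked,
   i.e. e is in C f C and f is in C e C; linking forces f B = B e = 0 and f e = 0.
   If some b in B has e b (1 - f), (1 - e) b f or (1 - e) b (1 - f) outside R, a
   regular lift of this Peirce component enlarges the pair.  Hence a pair with
   e C f + R of maximal dimension satisfies B <= e C f + R.
   Apply this to B' in A': by bar-minimality B' = e A' f, which lies in the
   regular inner ideal e A f of A.  The latter is bar-minimal: if B1 <= e A f has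
   the same image modulo rad A, the pair (e1, f1) of B1 satisfies e e1 = e1, so
   that e - e1 e is an idempotent of rad A, whence e = e1 e, likewise f = f f1,
   and e A f <= e1 A f1 <= B1. *)

(** * Unitization *)

Section Unitization.
Variables (F : fieldType) (A : vectType F) (mul : {bilinear A -> A -> A}).
Hypothesis mulA : associative mul.

(** The carrier does not depend on the proof of associativity; keeping that proof as an argument of
    the type lets the ring instance below recover it. *)
Definition unitization of associative mul : Type := (F^o * A)%type.
Local Notation K := (unitization mulA).

HB.instance Definition _ := Vector.copy K (F^o * A)%type.

Definition unitization_one : K := (1, 0).
Definition unitization_mul (x y : K) : K :=
  (x.1 * y.1, x.1 *: y.2 + y.1 *: x.2 + mul x.2 y.2).

Fact unitization_mulA : associative unitization_mul.
Proof.
move=> [a x] [b y] [c z]; congr pair => /=; first exact: mulrA.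
rewrite !(linearDl, linearDr, linearZl_LR, linearZr_LR) /= !scalerDr !scalerA mulA.
by rewrite [c * a]mulrC [c * b]mulrC !addrA (ACl (1*2*4*6*3*5*7)).

Qed.

Fact unitization_mul1 : left_id unitization_one unitization_mul.
Proof.
by case=> a x; rewrite /unitization_mul /= mul1r scale1r scaler0 linear0l !addr0.
Qed.

Fact unitization_1mul : right_id unitization_one unitization_mul.
Proof.
by case=> a x; rewrite /unitization_mul /= mulr1 scale1r scaler0 linear0r add0r addr0.
Qed.

Fact unitization_mulDl : left_distributive unitization_mul +%R.
Proof.
move=> [a x] [b y] [c z]; congr pair => /=; first exact: mulrDl.
by rewrite linearDl scalerDl scalerDr; rewrite !addrA (ACl (1*3*5*2*4*6)).
Qed.

Fact unitization_mulDr : right_distributive unitization_mul +%R.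
Proof.
move=> [a x] [b y] [c z]; congr pair => /=; first exact: mulrDr.
by rewrite linearDr scalerDl scalerDr; rewrite !addrA (ACl (1*3*5*2*4*6)).
Qed.

Fact unitization_one_neq0 : unitization_one != 0.
Proof. by rewrite -pair_eqE /= oner_eq0. Qed.

HB.instance Definition _ := GRing.Zmodule_isNzRing.Build K
  unitization_mulA unitization_mul1 unitization_1mul
  unitization_mulDl unitization_mulDr unitization_one_neq0.

Fact unitization_scaleAl (k : F) (x y : K) : k *: (x * y) = (k *: x) * y.
Proof.
case: x y => [a x] [b y]; congr pair => /=; first by rewrite /GRing.scale /= mulrA.
by rewrite !scalerDr !scalerA linearZl_LR [b * k]mulrC.
Qed.
HB.instance Definition _ := GRing.Lmodule_isLalgebra.Build F K unitization_scaleAl.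

Fact unitization_scaleAr (k : F) (x y : K) : k *: (x * y) = x * (k *: y).
Proof.
case: x y => [a x] [b y]; congr pair => /=.
  by rewrite /GRing.scale /= mulrCA.
by rewrite !scalerDr !scalerA linearZr_LR [a * k]mulrC.
Qed.
HB.instance Definition _ := GRing.Lalgebra_isAlgebra.Build F K unitization_scaleAr.
HB.instance Definition _ := Algebra_isFalgebra.Build F K.

Definition unitization_inj (x : A) : K := (0, x).

Fact unitization_inj_linear : linear unitization_inj.
Proof. by move=> k x y; congr pair; rewrite /= scaler0 addr0. Qed.
HB.instance Definition _ := GRing.isLinear.Build F A K _ _ unitization_inj_linear.

Lemma unitization_injM x y :
  unitization_inj (mul x y) = unitization_inj x * unitization_inj y.
Proof. by congr pair; rewrite /= ?mul0r ?scale0r ?add0r. Qed.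

End Unitization.

(** * Von Neumann regularity modulo the radical *)

Lemma nonincreasing_stable (f : nat -> nat) :
  (forall k, f k.+1 <= f k)%N -> exists k, f k.+1 = f k.
Proof.
have [n] := ubnP (f 0%N); elim: n f => // n IHn f le_f0 decf.
have := decf 0%N; rewrite leq_eqVlt => /predU1P[|lt_f10]; first by exists 0%N.
have [|k fk] := IHn (f \o succn) _ (fun k => decf k.+1); last by exists k.+1.
exact: leq_trans lt_f10 _.
Qed.

Section Falgebra.
Variables (F : fieldType) (K : falgType F).
Implicit Types (C I J N R U W : {vspace K}).

Lemma vline_prodvP a U x :
  reflect (exists2 u, u \in U & x = a * u) (x \in (<[a]> * U)%VS).
Proof.
suff ->: (<[a]> * U)%VS = (amull a @: U)%VS.
  by apply: (iffP memv_imgP) => -[u Uu ->]; exists u; rewrite ?lfunE.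
apply/eqP; rewrite eqEsubv; apply/andP; split; last first.
  by apply/subvP=> _ /memv_imgP[u Uu ->]; rewrite lfunE memv_mul ?memv_line.
apply/prodvP=> _ u /vlineP[k ->] Uu; apply/memv_imgP; exists (k *: u).
  exact: memvZ.
by rewrite lfunE /= -scalerAl scalerAr.
Qed.

(** A nil algebra acts nilpotently on a finite dimensional right module. For a in I, either a N is a
    smaller submodule and induction applies, or a N = I, so that a = a m with m nilpotent and a = 0.
    The exponents found for a basis of I are then added up. *)
Lemma nil_module_prodv_expv N I : (N * N <= N)%VS ->
    {in N, forall x, exists n, x ^+ n = 0} -> (I * N <= I)%VS ->
  exists n, (I * N ^+ n = 0)%VS.
Proof.
move=> NN nilN; have [d] := ubnP (\dim I); elim: d I => // d IHd I ltId IN.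
have line a : a \in I -> exists n, (<[a]> * N ^+ n = 0)%VS.
  move=> Ia; set J := (<[a]> * N)%VS.
  have sJI: (J <= I)%VS by apply: subv_trans IN; rewrite prodvSl // -memvE.
  have JN: (J * N <= J)%VS by rewrite -prodvA prodvSr.
  have := dimvS sJI; rewrite leq_eqVlt => /predU1P[eqJI | ltJI]; last first.
    have [|n Jn0] := IHd J _ JN; first exact: leq_trans ltJI _.
    by exists n.+1; rewrite expvSl prodvA.
  have /vline_prodvP[m Nm am]: a \in J.
    by suff ->: J = I by []; apply/eqP; rewrite eqEdim sJI eqJI leqnn.
  have [k mk0] := nilN m Nm.
  have aX j : a = a * m ^+ j.
    by elim: j => [|j IHj]; rewrite ?mulr1 // exprS mulrA -am.
  by exists 0%N; rewrite (aX k) mk0 mulr0 expv0 prodv1; apply/eqP; rewrite -subv0 -memvE memv0.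
suff [n n0]: exists n, (<<vbasis I>> * N ^+ n = 0)%VS.
  by exists n; rewrite -{1}(span_basis (vbasisP I)).
have: {subset (vbasis I : seq K) <= I} by move=> a; apply: vbasis_mem.
elim: (vbasis I : seq K) => {IHd ltId IN} [|a X IHX] sXI.
  by exists 0%N; rewrite span_nil prod0v.
have [n an0] := line a (sXI _ (mem_head _ _)).
have [|m Xm0] := IHX; first by move=> b Xb; rewrite sXI // inE Xb orbT.
exists (n + m)%N; rewrite span_cons prodvDl.
rewrite {1}expvD addnC expvD !prodvA an0 Xm0 !prod0v; exact: addv0.
Qed.

Section Subalgebra.
Variable C : {vspace K}.
Hypothesis CC : (C * C <= C)%VS.
Local Notation C1 := (1 + C)%VS.

Lemma subalgM : {in C &, forall x y, x * y \in C}.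
Proof. exact/prodvP. Qed.

Lemma subalg1M : {in C1 & C, forall x y, x * y \in C}.
Proof.
move=> _ y /memv_addP[_ /vlineP[k ->] [x Cx ->]] Cy.
by rewrite mulrDl -scalerAl mul1r memvD ?memvZ ?subalgM.
Qed.

Lemma subalgM1 : {in C & C1, forall x y, x * y \in C}.
Proof.
move=> x _ Cx /memv_addP[_ /vlineP[k ->] [y Cy ->]].
by rewrite mulrDr -scalerAr mulr1 memvD ?memvZ ?subalgM.
Qed.

Lemma memv_adj1 x : x \in C -> x \in C1.
Proof. exact/subvP/addvSr. Qed.

Lemma memv_adj1_1 : 1 \in C1.
Proof. exact: subvP (addvSl _ _) _ (memv_line _). Qed.

Lemma adj1M : {in C1 &, forall x y, x * y \in C1}.
Proof.
move=> x _ C1x /memv_addP[_ /vlineP[k ->] [y Cy ->]].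
by rewrite mulrDr -scalerAr mulr1 memvD ?memvZ // memv_adj1 // subalg1M.
Qed.

Lemma subalgX x n : x \in C -> x ^+ n.+1 \in C.
Proof. by move=> Cx; elim: n => // n IHn; rewrite exprS subalgM. Qed.

(* Fitting's lemma for left multiplication by z; s is a polynomial in z. *)
Lemma fitting z : z \in C -> exists s k,
  [/\ s \in C, z * s = s * z, z * s * (z * s) = z * s
    & z * s * z ^+ k.+1 = z ^+ k.+1].
Proof.
move=> Cz; pose W := ('C[z] :&: C1)%VS; pose V k := (<[z ^+ k]> * W)%VS.
have zW: (<[z]> * W <= W)%VS.
  apply/subvP=> _ /vline_prodvP[w Ww ->]; move: Ww; rewrite !memv_cap.
  case/andP=> /cent1vP cwz C1w; rewrite (adj1M (memv_adj1 Cz) C1w) andbT.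
  by apply/cent1vP; rewrite -mulrA cwz.
have sV k : (V k.+1 <= V k)%VS by rewrite /V exprSr -prodv_line -prodvA prodvSr.
have [k eqV] := nonincreasing_stable (fun k => dimvS (sV k)).
have /vline_prodvP[w Ww zk]: z ^+ k \in V k.+1.
  have ->: V k.+1 = V k by apply/eqP; rewrite eqEdim sV eqV leqnn.
  apply/vline_prodvP; exists 1; rewrite ?mulr1 // memv_cap memv_adj1_1 andbT.
  exact: cent1v1.
move: Ww; rewrite memv_cap => /andP[/cent1vP cwz C1w].
have zX n : z ^+ k = z ^+ k * (z * w) ^+ n.
  elim: n => [|n IHn]; first by rewrite mulr1.
  by rewrite exprS mulrA [z ^+ k * _]mulrA -exprSr -zk.
have zXm n : z ^+ k.+2 = z ^+ k.+2 * (z * w) ^+ n.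
  by rewrite -addn2 addnC exprD -mulrA -zX.
(* The idempotent is z s = (z w)^(k+2). Since w is only known to be in C1, the factors z w are what
   puts s into C. *)
pose s := w * (z * w) ^+ k.+1.
have zs: z * s = (z * w) ^+ k.+2 by rewrite mulrA -exprS.
have czw: GRing.comm z (z * w) by apply: commrM => //; apply/esym.
have Czw: z * w \in C by rewrite subalgM1.
have Pz: (z * w) ^+ k.+2 * z ^+ k.+2 = z ^+ k.+2.
  by rewrite [RHS](zXm k.+2); apply/commrX/commr_sym/commrX.
have czw' : GRing.comm z w by apply/esym.
exists s, k.+1; rewrite zs; split=> //.
- by rewrite subalg1M ?subalgX.
- by rewrite /s -mulrA -(commrX k.+1 czw) mulrA cwz -exprS.
- by rewrite {2}exprMn_comm // mulrA Pz -exprMn_comm.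
Qed.

Ltac memC := by repeat first
  [assumption | apply: memvB | apply: memvD | apply: subalgM].

(** An interface to the radical that can be stated in a unital ambient algebra K; the image of the
    radical under the embedding into the unitization satisfies it. *)
Record radical_ideal R : Prop := RadicalIdeal {
  radicalMl : {in C & R, forall x r, x * r \in R};
  radicalMr : {in R & C, forall r x, r * x \in R};
  radical_nil : {in R, forall r, exists n, r ^+ n = 0};
  radical_max : forall I n, (I <= C)%VS -> (C * I <= I)%VS -> (I * C <= I)%VS ->
    (I ^+ n.+1 = 0)%VS -> (I <= R)%VS }.

Variable R : {vspace K}.
Hypothesis radR : radical_ideal R.

(** J is nilpotent, being a nil algebra acting on itself. As J C1 <= J, the powers of the two-sided
    ideal C1 J satisfy (C1 J)^(n+1) <= C1 J^(n+1), so C1 J is nilpotent too, and it contains J. *)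
Lemma nil_right_ideal_sub_radical J : (J <= C)%VS -> (J * C1 <= J)%VS ->
  {in J, forall x, exists n, x ^+ n = 0} -> (J <= R)%VS.
Proof.
move=> sJC JC nilJ.
have JJ: (J * J <= J)%VS.
  apply: subv_trans JC; apply: prodvSr; exact: subv_trans (addvSr _ _).
have [n Jn0] := nil_module_prodv_expv JJ nilJ JJ; rewrite -expvSl in Jn0.
have CCJ: (C * C1 <= C)%VS by apply/prodvP=> x y Cx Cy; rewrite subalgM1.
have CJC: (C1 * J <= C)%VS.
  by apply/prodvP=> x y Cx Jy; rewrite subalg1M ?(subvP sJC).
suff sI: (C1 * J <= R)%VS.
  by apply: subv_trans sI; rewrite -{1}[J]prod1v prodvSl ?addvSl.
have C1I: (C1 * (C1 * J) <= C1 * J)%VS.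
  by rewrite prodvA prodvSl //; apply/prodvP; apply: adj1M.
apply: (@radical_max R radR _ n) => //.
- by apply: subv_trans C1I; rewrite prodvSl ?addvSr.
- rewrite -prodvA prodvSr //; apply: subv_trans JC; exact: prodvSr (addvSr _ _).
apply/eqP; rewrite -subv0 -(prodv0 C1) -Jn0.
elim: n {Jn0} => [|n IHn]; first by rewrite !expv1.
rewrite expvSr; apply: subv_trans (prodvSl _ IHn) _.
rewrite [in X in (_ <= X)%VS]expvSr !prodvA prodvSl // -!prodvA prodvSr //.
by rewrite expvSr -prodvA prodvSr.
Qed.

(** Enlarge an idempotent e = b x until e C is maximal. If the right ideal generated by b - e b is
    nil, it lies in R and x is the required element. Otherwise Fitting's lemma yields in it an
    idempotent g <> 0 with e g = 0, and e + g - g e is a larger idempotent of the form b x'. *)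
Lemma radical_regular b : b \in C -> exists2 x, x \in C & b * x * b - b \in R.
Proof.
move=> Cb.
suff regular d x : x \in C -> b * x * (b * x) = b * x ->
    (\dim C - \dim (<[b * x]> * C) < d)%N ->
  exists2 x, x \in C & b * x * b - b \in R.
  by apply: (regular _ 0 _ _ (leqnn _)); rewrite ?mem0v // mulr0 mul0r.
elim: d x => // d IHd x Cx; move def_e: (b * x) => e ee ltd.
have Ce: e \in C by rewrite -def_e subalgM.
have Cc: b - e * b \in C by memC.
pose J := (<[(b - e * b)%R]> * C1)%VS.
have sJC: (J <= C)%VS.
  by apply/subvP=> _ /vline_prodvP[y Cy ->]; rewrite subalgM1.
have JC: (J * C1 <= J)%VS.
  by rewrite -prodvA prodvSr //; apply/prodvP; apply: adj1M.
case: (classic {in J, forall z, exists n, z ^+ n = 0}) => [nilJ | /not_all_ex_not[z]].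
  exists x => //; rewrite def_e -opprB memvN.
  apply: subvP (nil_right_ideal_sub_radical sJC JC nilJ) _ _.
  by apply/vline_prodvP; exists 1; rewrite ?mulr1 ?memv_adj1_1.
move=> nJz; have [Jz nnz] := imply_to_and _ _ nJz.
have /vline_prodvP[c Cc1 zc] := Jz.
have [s [k [Cs zs gg gz]]] := fitting (subvP sJC _ Jz).
move def_g: (z * s) gg gz => g gg gz.
have g0: g != 0.
  by apply: contra_not_neq nnz => g0; exists k.+1; rewrite -gz g0 mul0r.
have eg: e * g = 0.
  by rewrite -def_g zc !mulrA mulrBr !mulrA ee subrr !mul0r.
have Cg: g \in C by rewrite -def_g subalgM // (subvP sJC).
(* This is read off from g = z s = (b - b x b) c s = b t. *)
pose t := c * s - x * b * (c * s).
have Ccs: c * s \in C by rewrite subalg1M.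
have Ct: t \in C by memC.
have gt: g = b * t.
  by rewrite -def_g zc /t -def_e !(mulrBr, mulrBl) !mulrA.
have Ee: (e + g - g * e) * e = e by rewrite mulrBl mulrDl -mulrA ee addrK.
have Eg: (e + g - g * e) * g = g by rewrite mulrBl mulrDl -mulrA eg gg mulr0 subr0 add0r.
have Eb: b * (x + t - t * e) = e + g - g * e by rewrite mulrBr mulrDr def_e mulrA -gt.
apply: (IHd (x + t - t * e)); rewrite ?Eb.
- memC.
- by rewrite mulrBr mulrDr mulrA Ee Eg.
set E := e + g - g * e in Ee Eg *.
have sEC: (<[E]> * C <= C)%VS.
  apply/subvP=> _ /vline_prodvP[y Cy ->]; rewrite subalgM //.
  by rewrite /E; memC.
have seE: (<[e]> * C <= <[E]> * C)%VS.
  apply/subvP=> _ /vline_prodvP[y Cy ->]; apply/vline_prodvP; exists (e * y).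
    by rewrite subalgM.
  by rewrite mulrA Ee.
suff lt_eE: (\dim (<[e]> * C) < \dim (<[E]> * C))%N.
  rewrite -ltnS; apply: leq_trans ltd; rewrite !ltnS ltn_sub2l //.
  exact: leq_trans lt_eE (dimvS sEC).
(* If e C = E C then g lies in e C, hence g = e g = 0. *)
rewrite ltn_neqAle dimvS // andbT; apply: contra g0 => /eqP eqd.
have: g \in (<[e]> * C)%VS.
  have ->: (<[e]> * C = <[E]> * C)%VS by apply/eqP; rewrite eqEdim seE eqd leqnn.
  by apply/vline_prodvP; exists g.
by case/vline_prodvP=> y _ gy; rewrite gy -ee -mulrA -gy eg.
Qed.

End Subalgebra.
End Falgebra.

(** * Linked corners of Jordan-Lie inner ideals *)

(** In the first alternative E is the join of e with an idempotent orthogonal to it on one side; in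
    the second e1 lies below e and E is e itself. *)
Lemma idempotent_join (T : nzRingType) (e e1 : T) (E := e + e1 - e * e1) :
    e * e = e -> e1 * e1 = e1 -> e1 * e = 0 \/ e * e1 = e1 /\ e1 * e = e1 ->
  [/\ E * E = E, E * e = e, e * E = e, E * e1 = e1 & e1 * E = e1].
Proof.
move=> ee e1e1 h.
have eE : e * E = e by rewrite mulrBr mulrDr mulrA ee addrK.
have Ee1 : E * e1 = e1 by rewrite mulrBl mulrDl -mulrA e1e1 addrAC subrr add0r.
have Ee : E * e = e.
  rewrite mulrBl mulrDl -mulrA ee.
  by case: h => [->|[ee1 ->]]; rewrite ?mulr0 ?subr0 ?addr0 // ee1 addrK.
have e1E : e1 * E = e1.
  rewrite mulrBr mulrDr mulrA e1e1.
  by case: h => [->|[_ ->]]; rewrite ?mul0r ?subr0 ?add0r // e1e1 addrK.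
by split=> //; rewrite {2}/E mulrBr mulrDr mulrA Ee Ee1.
Qed.

Section JordanLie.
Variables (F : fieldType) (K : falgType F) (C R B : {vspace K}).
Hypothesis CC : (C * C <= C)%VS.
Hypothesis radR : radical_ideal C R.
Hypothesis sBC : (B <= C)%VS.
Hypothesis BB : {in B &, forall b c, b * c = 0}.
Hypothesis BCB : {in B & C & B, forall b x c, b * x * c + c * x * b \in B}.
Hypothesis bCb : {in B & C, forall b x, b * x * b \in B}.
Local Notation C1 := (1 + C)%VS.

Let CM := subalgM CC.
Let RM := radicalMr radR.
Let MR := radicalMl radR.

Ltac memC := by repeat first [assumption | apply: memvB | apply: memvD | apply: CM].

(* With z = b x and the idempotent e = z s of Fitting's lemma, b r b = e b. *)
Lemma regular_lift b x : b \in C -> x \in C -> b * x * b - b \in R ->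
  exists r s, [/\ r \in C, s \in C, b * r * b - b \in R
    & b * r * b * (x * s * x) * (b * r * b) = b * r * b].
Proof.
move=> Cb Cx bxb; move def_z: (b * x) bxb => z zbR.
have Cz : z \in C by rewrite -def_z CM.
have [s [k [Cs zs ee ez]]] := fitting CC Cz.
move def_e: (z * s) ee ez => e ee ez.
have Ce : e \in C by rewrite -def_e CM.
have bxs : b * (x * s) * b = e * b by rewrite mulrA def_z def_e.
have zX j : z ^+ j.+1 - z \in R.
  elim: j => [|j IHj]; first by rewrite subrr mem0v.
  have -> : z ^+ j.+2 - z = z * (z ^+ j.+1 - z) + (z * b - b) * x.
    by rewrite mulrBr -exprS mulrBl -mulrA def_z addrA subrK.
  by apply: memvD; [apply: MR | apply: RM].
(* With y = x (s s b) x one has b y = z s s z = e, which gives (e b) y (e b) = e b. Having x at both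
   ends, y inherits relations such as x e = 0 or f x = 0. *)
exists (x * s), (s * s * b); split; rewrite ?CM // bxs.
  (* The middle summand is (e z - z) b; it lies in R because z and z^(k+1) are congruent modulo R
     and e fixes z^(k+1). *)
  rewrite (_ : _ - b = e * (b - z * b) + (e * (z - z ^+ k.+1) + (z ^+ k.+1 - z)) * b
                        + (z * b - b)); last first.
    have -> : e * (z - z ^+ k.+1) + (z ^+ k.+1 - z) = e * z - z.
      by rewrite mulrBr ez addrA subrK.
    by rewrite mulrBr mulrBl mulrA !addrA !subrK.
  apply: memvD (zbR); apply: memvD.
    by apply: MR => //; rewrite -opprB memvN.
  by apply: RM => //; apply: memvD (zX k); apply: MR; rewrite // -opprB memvN.
have -> : x * (s * s * b) * x = x * s * (s * z) by rewrite -def_z !mulrA.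
rewrite -zs def_e.
have -> : e * b * (x * s * e) * (e * b) = e * (b * x * s) * e * e * b.
  by rewrite !mulrA.
by rewrite def_z def_e !ee.
Qed.

Record linked_corner e f : Prop := LinkedCorner {
  lcl : e \in C; lcr : f \in C;
  lcl_idem : e * e = e; lcr_idem : f * f = f;
  lcl_linked : e \in (C * <[f]> * C)%VS; lcr_linked : f \in (C * <[e]> * C)%VS;
  lc_sub : {in C, forall x, e * x * f \in B} }.

(** This is how linking is exploited: W will be the kernel of a linear map or the preimage of a
    subspace, so that a linear statement about e need only be checked on the products c f d. *)
Lemma linked_mem e f (W : {vspace K}) :
  e \in (C * <[f]> * C)%VS -> {in C &, forall c d, c * f * d \in W} -> e \in W.
Proof.
move=> ef cfdW; apply: subvP e ef; rewrite -prodvA.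
apply/prodvP=> c _ Cc /vline_prodvP[d Cd ->].
by rewrite mulrA cfdW.
Qed.

Section LinkedCorner.
Variables e f : K.
Hypothesis ef : linked_corner e f.
Let Ce := lcl ef.
Let Cf := lcr ef.
Let ee := lcl_idem ef.
Let ff := lcr_idem ef.

(** Spread f into products c e d: then c e d f b = c (e d f) b vanishes, as both e d f and b lie in
    B and B^2 = 0. *)
Lemma corner_mulB b : b \in B -> f * b = 0.
Proof.
move=> Bb; suff: f \in lker (amulr (f * b)).
  by rewrite memv_ker lfunE /= mulrA ff => /eqP.
apply: linked_mem (lcr_linked ef) _ => c d Cc Cd; rewrite memv_ker lfunE /=.
have -> : c * e * d * (f * b) = c * (e * d * f * b) by rewrite !mulrA.
by rewrite (BB (lc_sub ef Cd) Bb) mulr0.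
Qed.

Lemma mulB_corner b : b \in B -> b * e = 0.
Proof.
move=> Bb; suff: e \in lker (amull (b * e)).
  by rewrite memv_ker lfunE /= -mulrA ee => /eqP.
apply: linked_mem (lcl_linked ef) _ => c d Cc Cd; rewrite memv_ker lfunE /=.
have -> : b * e * (c * f * d) = b * (e * c * f) * d by rewrite !mulrA.
by rewrite (BB Bb (lc_sub ef Cc)) mul0r.
Qed.

Lemma corner_orthogonal : f * e = 0.
Proof.
suff: e \in lker (amull (f * e)).
  by rewrite memv_ker lfunE /= -mulrA ee => /eqP.
apply: linked_mem (lcl_linked ef) _ => c d Cc Cd; rewrite memv_ker lfunE /=.
have -> : f * e * (c * f * d) = f * (e * c * f) * d by rewrite !mulrA.
by rewrite corner_mulB ?mul0r ?(lc_sub ef).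
Qed.

(** Once e is spread into products a f d, the element is one half of a sum (e a f) w b + b w (e a f)
    in B. The other half contains b y e or b f, depending on the alternative, and vanishes. *)
Lemma corner_absorb_r b y c : b \in B -> y \in C -> c \in C ->
  b * y * b = b -> b * y * e = 0 \/ b * f = 0 -> e * c * (y * b) \in B.
Proof.
move=> Bb Cy Cc byb h; have Cb := subvP sBC _ Bb.
suff: e \in ((amulr (c * y * b) \o amull e) @^-1: B)%VS.
  by rewrite -memv_preim comp_lfunE !lfunE /= ee !mulrA.
apply: linked_mem (lcl_linked ef) _ => a d Ca Cd.
rewrite -memv_preim comp_lfunE !lfunE /=; have Beaf := lc_sub ef Ca.
case: h => [bye | bf].
  have -> : e * (a * f * d) * (c * y * b) =
      e * a * f * (f * d * c * y * (b * y)) * b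
      + b * (f * d * c * y * (b * y)) * (e * a * f).
    have -> : b * (f * d * c * y * (b * y)) * (e * a * f) =
      b * (f * d * c * y) * (b * y * e) * a * f by rewrite !mulrA.
    rewrite bye mulr0 !mul0r addr0.
    have -> : e * a * f * (f * d * c * y * (b * y)) * b
       = e * a * (f * f) * d * c * y * (b * y * b) by rewrite !mulrA.
    by rewrite byb ff !mulrA.
  by apply: BCB => //; memC.
have -> : e * (a * f * d) * (c * y * b) =
    e * a * f * (f * d * c * y) * b + b * (f * d * c * y) * (e * a * f).
  by rewrite !mulrA bf !mul0r addr0 -[_ * f * f]mulrA ff.
by apply: BCB => //; memC.
Qed.

Lemma corner_absorb_l b y c : b \in B -> y \in C -> c \in C ->
  b * y * b = b -> f * (y * b) = 0 \/ e * b = 0 -> b * y * c * f \in B.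
Proof.
move=> Bb Cy Cc byb h; have Cb := subvP sBC _ Bb.
suff: f \in ((amulr f \o amull (b * y * c)) @^-1: B)%VS.
  by rewrite -memv_preim comp_lfunE !lfunE /= -[_ * f * f]mulrA ff.
apply: linked_mem (lcr_linked ef) _ => d a Cd Ca.
rewrite -memv_preim comp_lfunE !lfunE /=; have Beaf := lc_sub ef Ca.
case: h => [fyb | eb].
  have -> : b * y * c * (d * e * a) * f =
      b * (y * b * (y * c * d * e)) * (e * a * f)
      + e * a * f * (y * b * (y * c * d * e)) * b.
    have -> : e * a * f * (y * b * (y * c * d * e)) * b =
      e * a * (f * (y * b)) * (y * c * d * e) * b by rewrite !mulrA.
    rewrite fyb mulr0 !mul0r addr0.
    have -> : b * (y * b * (y * c * d * e)) * (e * a * f)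
       = (b * y * b) * y * c * d * (e * e) * a * f by rewrite !mulrA.
    by rewrite byb ee !mulrA.
  by apply: BCB => //; memC.
have -> : b * y * c * (d * e * a) * f =
    b * (y * c * d * e) * (e * a * f) + e * a * f * (y * c * d * e) * b.
  have -> : e * a * f * (y * c * d * e) * b = e * a * f * (y * c * d) * (e * b).
    by rewrite !mulrA.
  by rewrite eb mulr0 addr0 !mulrA -[_ * e * e]mulrA ee.
by apply: BCB => //; memC.
Qed.

(* If c = b r b is the regular lift of b and y = x s x, the idempotents e1 = c y
   and f1 = y c are joined to e and f: E K = e K + e1 K and K G = K f + K f1. *)
Lemma linked_corner_extend b x : b \in C -> x \in C ->
    {in C, forall c, b * c * b \in B} -> b * x * b - b \in R ->
    x * e = 0 \/ [/\ e * b = b, x * e = x & b * f = 0] ->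
    f * x = 0 \/ [/\ b * f = b, f * x = x & e * b = 0] ->
  exists E G b', [/\ linked_corner E G, E * e = e, f * G = f,
    b' - b \in R & b' = E * b' * G /\ b' \in C].
Proof.
move=> Cb Cx bCbB bxb he hf.
have [r [s [Cr Cs brbR]]] := regular_lift Cb Cx bxb.
move def_c: (b * r * b) brbR => c cR; move def_y: (x * s * x) => y cyc.
have Bc : c \in B by rewrite -def_c bCbB.
have Cc := subvP sBC _ Bc.
have Cy : y \in C by rewrite -def_y; memC.
have fc := corner_mulB Bc; have ce := mulB_corner Bc; have cc := BB Bc Bc.
have he1 : c * y * e = 0 \/ [/\ e * c = c, c * y * e = c * y & c * f = 0].
  case: he => [xe | [eb xe bf]]; [left | right; split].
  - by rewrite -def_y -!mulrA xe !mulr0.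
  - by rewrite -def_c !mulrA eb.
  - by rewrite -def_y -!mulrA xe.
  - by rewrite -def_c -!mulrA bf !mulr0.
have hf1 : f * (y * c) = 0 \/ [/\ c * f = c, f * (y * c) = y * c & e * c = 0].
  case: hf => [fx | [bf fx eb]]; [left | right; split].
  - by rewrite -def_y !mulrA fx !mul0r.
  - by rewrite -def_c -!mulrA bf.
  - by rewrite -def_y !mulrA fx.
  - by rewrite -def_c !mulrA eb !mul0r.
have ecf1 z : z \in C -> e * z * (y * c) \in B.
  move=> Cz; apply: corner_absorb_r => //.
  by case: he1 => [|[_ _]]; [left | right].
have e1cf z : z \in C -> c * y * z * f \in B.
  move=> Cz; apply: corner_absorb_l => //.
  by case: hf1 => [|[_ _]]; [left | right].
have e1cf1 z : z \in C -> c * y * z * (y * c) \in B.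
  move=> Cz; have -> : c * y * z * (y * c) = c * (y * z * y) * c by rewrite !mulrA.
  by apply: bCb => //; memC.
move def_e1: (c * y) he1 e1cf e1cf1 => e1 he1 e1cf e1cf1.
move def_f1: (y * c) hf1 ecf1 e1cf1 => f1 hf1 ecf1 e1cf1.
have Ce1 : e1 \in C by rewrite -def_e1 CM.
have Cf1 : f1 \in C by rewrite -def_f1 CM.
have e1c : e1 * c = c by rewrite -def_e1 cyc.
have cf1 : c * f1 = c by rewrite -def_f1 mulrA cyc.
have e1e1 : e1 * e1 = e1 by rewrite -{2}def_e1 mulrA e1c.
have f1f1 : f1 * f1 = f1 by rewrite -{1}def_f1 -mulrA cf1.
have he2 : e1 * e = 0 \/ e * e1 = e1 /\ e1 * e = e1.
  case: he1 => [|[ec e1e _]]; [by left | right; split=> //].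
  by rewrite -def_e1 mulrA ec.
have hf2 : f * f1 = 0 \/ f1 * f = f1 /\ f * f1 = f1.
  case: hf1 => [|[cf ff1 _]]; [by left | right; split=> //].
  by rewrite -def_f1 -mulrA cf.
have := idempotent_join ee e1e1 he2; set E := e + e1 - _ => -[EE Ee eE Ee1 e1E].
(* The same computation for f, f1 in the converse ring. *)
have := @idempotent_join K^c f f1 ff f1f1 hf2.
set G : K := f + f1 - f1 * f => -[GG fG Gf f1G Gf1].
rewrite /GRing.mul /= in GG fG Gf f1G Gf1.
have e1f1c : e1 * c * f1 = c by rewrite e1c cf1.
have CE : E \in C by rewrite /E; memC.
have CG : G \in C by rewrite /G; memC.
exists E, G, c; split=> //; last first.
  split=> //; rewrite -{2}e1f1c !mulrA Ee1 -!mulrA f1G !mulrA.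
  by rewrite e1f1c.
have Ec : E * c = c by rewrite -{1}e1c mulrA Ee1 e1c.
have cG : c * G = c by rewrite -{1}cf1 -mulrA f1G cf1.
split=> //.
(* Each summand of E is linked to G: f = f G handles e, and e1 = c y = c G y handles e1 and e e1. *)
- have CGC a d : a \in C -> d \in C -> a * G * d \in (C * <[G]> * C)%VS.
    by move=> Ca Cd; rewrite !memv_mul ?memv_line.
  apply: memvB; first apply: memvD.
  + apply: linked_mem (lcl_linked ef) _ => a d Ca Cd.
    by rewrite -fG mulrA CGC ?CM.
  + by rewrite -def_e1 -cG CGC.
  + by rewrite -def_e1 -cG mulrA mulrA CGC ?CM.
- have CEC a d : a \in C -> d \in C -> a * E * d \in (C * <[E]> * C)%VS.
    by move=> Ca Cd; rewrite !memv_mul ?memv_line.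
  apply: memvB; first apply: memvD.
  + apply: linked_mem (lcr_linked ef) _ => a d Ca Cd.
    by rewrite -Ee mulrA -[_ * d]mulrA CEC ?CM.
  + by rewrite -def_f1 -Ec mulrA CEC.
  + by rewrite -def_f1 -Ec mulrA -mulrA CEC ?CM.
(* E z G is split into terms of e C f, e C f1, e1 C f and e1 C f1, each of which is contained in
   B. *)
- move=> z Cz.
  have -> : E * z * G = e * (z - e1 * z) * G + e1 * z * G.
    by rewrite -mulrDl; congr (_ * _); rewrite /E mulrBr mulrBl mulrDl !mulrA addrAC.
  have dG d : d * G = (d - d * f1) * f + d * f1.
    by rewrite /G mulrBr mulrDr mulrBl !mulrA addrAC.
  rewrite !dG; apply: memvD; apply: memvD.
  + have -> : e * (z - e1 * z) - e * (z - e1 * z) * f1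
       = e * (z - e1 * z - (z - e1 * z) * f1) by rewrite [RHS]mulrBr !mulrA.
    by apply: (lc_sub ef); memC.
  + by apply: ecf1; memC.
  + have -> : e1 * z - e1 * z * f1 = e1 * (z - z * f1) by rewrite mulrBr mulrA.
    by apply: e1cf; memC.
  + exact: e1cf1.
Qed.

(** For strictness: otherwise the lift c of b, which lies in E C G, is z + q with z in e C f and q
    in R. Modulo R, z = e z f is congruent to e b f = 0, so c and then b would lie in R. *)
Lemma linked_corner_progress b x : b \in C -> x \in C ->
    {in C, forall c, b * c * b \in B} -> b * x * b - b \in R ->
    x * e = 0 \/ [/\ e * b = b, x * e = x & b * f = 0] ->
    f * x = 0 \/ [/\ b * f = b, f * x = x & e * b = 0] ->
    e * b * f = 0 -> b \notin R ->
  exists E G, linked_corner E G /\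
    (\dim (<[e]> * C * <[f]> + R) < \dim (<[E]> * C * <[G]> + R))%N.
Proof.
move=> Cb Cx bCbB bxb he hf ebf nRb.
have [E [G [c [EG Ee fG cb [cE Cc]]]]] := linked_corner_extend Cb Cx bCbB bxb he hf.
exists E, G; split=> //.
have sef : (<[e]> * C * <[f]> <= <[E]> * C * <[G]>)%VS.
  apply/prodvP=> _ _ /vline_prodvP[a Ca ->] /vlineP[k ->].
  rewrite -scalerAr memvZ // -Ee -fG mulrA memv_mul ?memv_line //.
  by rewrite -!mulrA memv_mul ?memv_line ?CM.
rewrite ltn_neqAle dimvS ?addvS ?subvv // andbT; apply: contra nRb => /eqP eqd.
have: c \in (<[e]> * C * <[f]> + R)%VS.
  have -> : (<[e]> * C * <[f]> + R = <[E]> * C * <[G]> + R)%VS.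
    by apply/eqP; rewrite eqEdim addvS ?subvv // eqd leqnn.
  apply: subvP (addvSl _ _) _ _.
  by rewrite cE !memv_mul ?memv_line.
case/memv_addP=> z zef [q Rq cq].
have ezf : e * z * f = z.
  case/memv_cosetP: zef => _ /vline_prodvP[a Ca ->] ->.
  by rewrite !mulrA ee -mulrA ff.
have Rz : z \in R.
  rewrite -ezf (_ : z = (c - b) - q + b); last by rewrite addrAC subrK cq addrK.
  by rewrite mulrDr mulrDl ebf addr0 RM ?MR // memvB.
have -> : b = c - (c - b) by rewrite opprB addrC subrK.
by rewrite memvB // cq memvD.
Qed.

(** A correction from b f C f moves e b into B. Spreading the leading e of e b into products a f d
    gives terms e a f d e b, and adding b (f d e) (e a f) to such a term gives an element of B. *)
Lemma corner_add_mem_l b : b \in B ->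
  exists2 w, w \in C & e * b + b * f * w * f \in B.
Proof.
move=> Bb; have Cb := subvP sBC _ Bb.
suff: e \in ((amulr (e * b) \o amull e) @^-1: (B + <[(b * f)%R]> * C * <[f]>))%VS.
  rewrite -memv_preim comp_lfunE !lfunE /= ee mulrA ee => /memv_addP[p Bp [q]].
  case/memv_cosetP=> _ /vline_prodvP[w Cw ->] -> ebp.
  exists (- w); first by rewrite memvN.
  by rewrite ebp mulrN mulNr addrK.
apply: linked_mem (lcl_linked ef) _ => a d Ca Cd.
rewrite -memv_preim comp_lfunE !lfunE /=; have Beaf := lc_sub ef Ca.
have -> : e * (a * f * d) * (e * b) =
    (e * a * f * (f * d * e) * b + b * (f * d * e) * (e * a * f))
    + b * f * (- (d * e * a)) * f.
  rewrite mulrN mulNr !mulrA -[_ * f * f]mulrA ff -[_ * e * e]mulrA ee addrK.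
  by [].
rewrite memv_add //; first by apply: BCB => //; memC.
rewrite !memv_mul ?memv_line // memvN; memC.
Qed.

Lemma corner_add_mem_r b : b \in B ->
  exists2 w, w \in C & e * w * (e * b) + b * f \in B.
Proof.
move=> Bb; have Cb := subvP sBC _ Bb.
suff: f \in ((amulr f \o amull (b * f)) @^-1: (B + <[e]> * C * <[(e * b)%R]>))%VS.
  rewrite -memv_preim comp_lfunE !lfunE /= -[b * f * f]mulrA ff -mulrA ff.
  case/memv_addP=> p Bp [q /memv_cosetP[_ /vline_prodvP[w Cw ->] ->] bfp].
  exists (- w); first by rewrite memvN.
  by rewrite bfp mulrN mulNr addrC addrK.
apply: linked_mem (lcr_linked ef) _ => d a Cd Ca.
rewrite -memv_preim comp_lfunE !lfunE /=; have Beaf := lc_sub ef Ca.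
have -> : b * f * (d * e * a) * f =
    (e * a * f * (f * d * e) * b + b * (f * d * e) * (e * a * f))
    + e * (- (a * f * d)) * (e * b).
  rewrite mulrN mulNr !mulrA -[_ * f * f]mulrA ff -[_ * e * e]mulrA ee.
  by rewrite addrAC subrr add0r.
rewrite memv_add //; first by apply: BCB => //; memC.
rewrite !memv_mul ?memv_line // memvN; memC.
Qed.

(* u, v and t are the Peirce components of b outside e C f. *)
Lemma linked_corner_step b : b \in B -> b - e * b * f \notin R ->
  exists E G, linked_corner E G /\
    (\dim (<[e]> * C * <[f]> + R) < \dim (<[E]> * C * <[G]> + R))%N.
Proof.
move=> Bb nRb0; have Cb := subvP sBC _ Bb.
have fb := corner_mulB Bb; have be := mulB_corner Bb.
pose h := 1 - e; pose g := 1 - f.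
have C1h : h \in C1.
  by rewrite memvB ?memv_adj1_1 ?memv_adj1.
have C1g : g \in C1.
  by rewrite memvB ?memv_adj1_1 ?memv_adj1.
have eh : e * h = 0 by rewrite mulrBr mulr1 ee subrr.
have he : h * e = 0 by rewrite mulrBl mul1r ee subrr.
have hh : h * h = h by rewrite {2}/h mulrBr mulr1 he subr0.
have fg : f * g = 0 by rewrite mulrBr mulr1 ff subrr.
have gf : g * f = 0 by rewrite mulrBl mul1r ff subrr.
have gg : g * g = g by rewrite {2}/g mulrBr mulr1 gf subr0.
have eDh : e + h = 1 by rewrite addrC subrK.
have fDg : f + g = 1 by rewrite addrC subrK.
clearbody h g.
have corner z : z \in C -> e * z * f \in B by apply: (lc_sub ef).
move def_u: (e * b * g) => u; move def_v: (h * b * f) => v.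
have Cu : u \in C by rewrite -def_u subalgM1 // CM.
have Cv : v \in C by rewrite -def_v CM // subalg1M.
have ebE : e * b = e * b * f + u by rewrite -def_u -mulrDr fDg mulr1.
have bfE : b * f = e * b * f + v by rewrite -def_v -!mulrDl eDh mul1r.
have eu : e * u = u by rewrite -def_u !mulrA ee.
have vf : v * f = v by rewrite -def_v -mulrA ff.
(* Put p = e b + b f w f in B. As f g = 0, p (g c e) p = u c e p, which differs from u c u by an
   element of e C f. *)
have uCu : {in C, forall c, u * c * u \in B}.
  move=> c Cc; have [w Cw Bp] := corner_add_mem_l Bb.
  have -> : u * c * u = (e * b + b * f * w * f) * (g * c * e) * (e * b + b * f * w * f)
      - e * (u * c * e * b + u * c * e * b * f * w) * f.
    have -> : (e * b + b * f * w * f) * (g * c * e) = u * c * e.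
      by rewrite -def_u mulrDl !mulrA -[_ * f * g]mulrA fg mulr0 !mul0r addr0.
    have uceb : u * c * e * b = u * c * e * b * f + u * c * u.
      by rewrite -[_ * e * b]mulrA {1}ebE mulrDr !mulrA.
    rewrite mulrDr [e * (_ + _)]mulrDr mulrDl !mulrA eu -[_ * e * e]mulrA ee.
    by rewrite {1}uceb opprD addrACA subrr addr0 addrAC subrr add0r.
  rewrite memvB //.
    by apply: bCb => //; apply: CM => //; rewrite subalg1M.
  by apply: corner; memC.
have vCv : {in C, forall c, v * c * v \in B}.
  move=> c Cc; have [w Cw Bp] := corner_add_mem_r Bb.
  have -> : v * c * v = (e * w * (e * b) + b * f) * (f * c * h) * (e * w * (e * b) + b * f)
      - e * (b * f * c * v + w * e * b * f * c * v) * f.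
    have -> : (e * w * (e * b) + b * f) * (f * c * h) * (e * w * (e * b) + b * f)
        = (e * w * (e * b) + b * f) * (f * c * v).
      rewrite -[LHS]mulrA; congr (_ * _); rewrite mulrDr !mulrA -[_ * h * e]mulrA he !(mulr0, mul0r).
      by rewrite add0r -def_v !mulrA.
    have bfcv : b * f * c * v = e * b * f * c * v + v * c * v.
      by rewrite bfE !mulrDl.
    rewrite mulrDr !mulrDl !mulrA -[_ * v * f]mulrA vf -![_ * f * f]mulrA ff.
    rewrite -[_ * v * f]mulrA vf.
    by rewrite {1}bfcv addrA [e * b * f * c * v + _]addrC [RHS]addrAC subrr add0r.
  rewrite memvB //.
    by apply: bCb => //; apply: subalgM1 => //; memC.
  by apply: corner; memC.
have [Ru | nRu] := boolP (u \in R); last first.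
  have [x Cx uxu] := radical_regular CC radR Cu.
  have Cgx : g * x \in C by rewrite subalg1M.
  (* Since u = e b g, the inverse x of u modulo R may be cut down to g x e, which has the required
     relations with e and f. *)
  apply: (@linked_corner_progress u (g * x * e)) => //.
  - by memC.
  - by rewrite (_ : u * _ * u = u * x * u) // -def_u !mulrA -[_ * g * g]mulrA gg -[_ * e * e]mulrA ee.
  - right; split; first by rewrite -def_u !mulrA ee.
      by rewrite -!mulrA ee.
    by rewrite -def_u -mulrA gf mulr0.
  - by left; rewrite !mulrA fg !mul0r.
  - by rewrite -def_u !mulrA -[_ * g * f]mulrA gf mulr0.
have [Rv | nRv] := boolP (v \in R); last first.
  have [x Cx vxv] := radical_regular CC radR Cv.
  have Cfxh : f * x * h \in C by rewrite subalgM1 // CM.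
  apply: (@linked_corner_progress v (f * x * h)) => //.
  - by rewrite (_ : v * _ * v = v * x * v) // -def_v !mulrA -[_ * f * f]mulrA ff -[_ * h * h]mulrA hh.
  - by left; rewrite -!mulrA he !mulr0.
  - right; split; first by rewrite -def_v -!mulrA ff.
      by rewrite !mulrA ff.
    by rewrite -def_v !mulrA eh !mul0r.
  - by rewrite -def_v !mulrA eh !mul0r.
move def_t: (h * b * g) => t; have Ct : t \in C by rewrite -def_t subalgM1 // subalg1M.
have bE : b = e * b * f + (u + v + t).
  rewrite -[LHS]mul1r -eDh mulrDl {1}ebE -[h * b]mulr1 -fDg mulrDr def_v def_t.
  by rewrite -!addrA.
(* Now u and v are in R, so b0 is congruent to t. Being in B, b0 takes the place of t in the
   enlargement, and an inverse of t modulo R serves for b0. *)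
have b0E : b - e * b * f = u + v + t by rewrite {1}bE addrAC subrr add0r.
move def_b0: (b - _) nRb0 => b0 nRb0.
have Bb0 : b0 \in B by rewrite -def_b0 memvB ?corner.
have Rtb0 : b0 - t \in R by rewrite -def_b0 b0E addrK memvD.
have Cb0 := subvP sBC _ Bb0.
have [x Cx txt] := radical_regular CC radR Ct.
have Chxg : g * x * h \in C by rewrite subalgM1 // subalg1M.
have {}txt : t * (g * x * h) * t - t \in R.
  by rewrite (_ : t * _ * t = t * x * t) // -def_t !mulrA -[_ * g * g]mulrA gg -[_ * h * h]mulrA hh.
apply: (@linked_corner_progress b0 (g * x * h)) => //.
- by move=> c Cc; apply: bCb.
- have -> : b0 * (g * x * h) * b0 - b0 = (b0 - t) * ((g * x * h) * b0)
     + t * (g * x * h) * (b0 - t) + (t * (g * x * h) * t - t) - (b0 - t).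
    by rewrite mulrBl mulrBr !mulrA !addrA !subrK opprB addrA subrK.
  apply: memvB => //; apply: memvD => //; apply: memvD; [apply: RM | apply: MR] => //; memC.
- by left; rewrite -!mulrA he !mulr0.
- by left; rewrite !mulrA fg !mul0r.
- by rewrite -def_b0 mulrBr mulrBl !mulrA ee -[_ * f * f]mulrA ff subrr.
Qed.
End LinkedCorner.

Theorem jordan_lie_linked_corner : exists e f,
  linked_corner e f /\ {in B, forall b, b - e * b * f \in R}.
Proof.
suff max d e f : linked_corner e f ->
    (\dim {:K} - \dim (<[e]> * C * <[f]> + R) < d)%N ->
  exists e f, linked_corner e f /\ {in B, forall b, b - e * b * f \in R}.
  (* The pair (0, 0) is linked and starts the induction on the codimension of e C f + R. *)
  apply: (max _ 0 0 _ (leqnn _)).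
  by split; rewrite ?mul0r ?mem0v // => x _; rewrite !mul0r mem0v.
elim: d e f => // d IHd e f ef ltd.
case: (classic {in B, forall b, b - e * b * f \in R}) => [Bef | /not_all_ex_not[b nb]].
  by exists e, f.
have [Bb /negP nRb] := imply_to_and _ _ nb.
have [E [G [EG lt_ef_EG]]] := linked_corner_step ef Bb nRb.
apply: (IHd E G EG); rewrite -ltnS; apply: leq_trans ltd.
by rewrite !ltnS ltn_sub2l // (leq_trans lt_ef_EG) // dimvS ?subvf.
Qed.

End JordanLie.

(** * Comparison of two linked corners with the same image modulo the radical *)

Section Minimality.
Variables (F : fieldType) (K : falgType F) (C R : {vspace K}).
Hypothesis CC : (C * C <= C)%VS.
Hypothesis radR : radical_ideal C R.

Lemma radical_idempotent e : e \in R -> e * e = e -> e = 0.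
Proof.
move=> Re ee; have [n en0] := radical_nil radR Re.
suff eX : e * e ^+ n = e by rewrite -eX en0 mulr0.
by elim: n {en0} => [|n IHn]; rewrite ?mulr1 // exprS mulrA ee.
Qed.

Lemma linked_corner_minimal B B1 e f e1 f1 :
    linked_corner C B e f -> linked_corner C B1 e1 f1 ->
    (B1 <= <[e]> * C * <[f]>)%VS -> {in C, forall x, e * x * f \in (B1 + R)%VS} ->
    {in B1, forall b, b - e1 * b * f1 \in R} ->
  {in C, forall x, e * x * f \in B1}.
Proof.
move=> ef ef1 sB1 eCf B1R.
have [Ce Cf ee ff e_f f_e _] := ef; have [Ce1 Cf1 ee1 ff1 e1_f1 f1_e1 e1Cf1] := ef1.
have B1P b : b \in B1 -> e * b = b /\ b * f = b.
  move/(subvP sB1) => /memv_cosetP[_ /vline_prodvP[x _ ->] ->].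
  by rewrite !mulrA ee -[_ * f * f]mulrA ff.
(* e1 = e1 e1 is a sum of products (e1 c f1) d with e1 c f1 in B1, and e fixes B1 from the left. *)
have e_e1 : e * e1 = e1.
  suff /vline_prodvP[x _ ->]: e1 \in (<[e]> * fullv)%VS by rewrite mulrA ee.
  suff: e1 \in (amull e1 @^-1: (<[e]> * fullv))%VS.
    by rewrite -memv_preim lfunE /= ee1.
  apply: linked_mem e1_f1 _ => c d Cc Cd; rewrite -memv_preim lfunE /= !mulrA.
  have [<- _] := B1P _ (e1Cf1 c Cc).
  by rewrite -[_ * d]mulrA memv_mul ?memv_line ?memvf.
have f1_f : f1 * f = f1.
  suff /memv_cosetP[x _ ->]: f1 \in (fullv * <[f]>)%VS by rewrite -mulrA ff.
  suff: f1 \in (amulr f1 @^-1: (fullv * <[f]>))%VS.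
    by rewrite -memv_preim lfunE /= ff1.
  apply: linked_mem f1_e1 _ => c d Cc Cd; rewrite -memv_preim lfunE /= -!mulrA.
  rewrite [e1 * _]mulrA; have [_ <-] := B1P _ (e1Cf1 d Cd).
  by rewrite mulrA memv_mul ?memv_line ?memvf.
have CM := subalgM CC; have RM := radicalMr radR; have MR := radicalMl radR.
have B1Re b : b \in (B1 + R)%VS -> b - e1 * b \in R.
  case/memv_addP=> c Bc [r Rr ->].
  have -> : c + r - e1 * (c + r) =
      (c - e1 * c * f1 - e1 * (c - e1 * c * f1)) + (r - e1 * r).
    have -> : c - e1 * c * f1 - e1 * (c - e1 * c * f1) = c - e1 * c.
      by rewrite mulrBr !mulrA ee1 opprB addrA subrK.
    by rewrite mulrDr opprD addrACA.
  have Rc := B1R c Bc; by apply: memvD; apply: memvB => //; apply: MR.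
have B1Rf b : b \in (B1 + R)%VS -> b - b * f1 \in R.
  case/memv_addP=> c Bc [r Rr ->].
  have -> : c + r - (c + r) * f1 =
      (c - e1 * c * f1 - (c - e1 * c * f1) * f1) + (r - r * f1).
    have -> : c - e1 * c * f1 - (c - e1 * c * f1) * f1 = c - c * f1.
      by rewrite mulrBl -[_ * f1 * f1]mulrA ff1 opprB addrA subrK.
    by rewrite mulrDl opprD addrACA.
  have Rc := B1R c Bc; by apply: memvD; apply: memvB => //; apply: RM.
(* The difference e - e1 e is idempotent because e e1 = e1. It lies in R: spreading its right factor
   e into products c f d leaves (e c f - e1 e c f) d, and e c f is in B1 + R. *)
have e1e : e = e1 * e.
  apply/eqP; rewrite -subr_eq0; apply/eqP/radical_idempotent; last first.
    by rewrite mulrBr !mulrBl ee !mulrA -[_ * e * e]mulrA ee -[_ * e * e1]mulrA e_e1 ee1 subrr subr0.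
  suff: e \in (amull (e - e1 * e) @^-1: R)%VS.
    by rewrite -memv_preim lfunE /= mulrBl -mulrA ee.
  apply: linked_mem e_f _ => c d Cc Cd; rewrite -memv_preim lfunE /= mulrA RM //.
  by rewrite mulrA !mulrBl -!mulrA B1Re // mulrA eCf.
have ff1' : f = f * f1.
  apply/eqP; rewrite -subr_eq0; apply/eqP/radical_idempotent; last first.
    by rewrite mulrBl !mulrBr ff !mulrA ff -[_ * f1 * f]mulrA f1_f -[_ * f1 * f1]mulrA ff1 subrr subr0.
  suff: f \in (amulr (f - f * f1) @^-1: R)%VS.
    by rewrite -memv_preim lfunE /= mulrBr mulrA ff.
  apply: linked_mem f_e _ => c d Cc Cd; rewrite -memv_preim lfunE /= -!mulrA MR //.
  by rewrite mulrA !mulrBr !mulrA B1Rf // eCf.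
move=> x Cx; rewrite e1e ff1'.
have -> : e1 * e * x * (f * f1) = e1 * (e * x * f) * f1 by rewrite !mulrA.
by rewrite e1Cf1 ?CM.
Qed.
End Minimality.

(** * Transfer from the unitization *)

Section Transfer.
Variables (F : fieldType) (A : vectType F) (mul : {bilinear A -> A -> A}).
Hypothesis mulA : associative mul.
Implicit Types (U V W C B : {vspace A}).

Lemma commutator_commutator a b c : mul a b = 0 -> mul b a = 0 ->
  commutator mul a (commutator mul b c) = - (mul (mul a c) b + mul (mul b c) a).
Proof.
move=> ab ba; rewrite /commutator !linearBr /= !linearBl /= !mulA ab.
by rewrite -[mul (mul c b) a]mulA ba linear0l linear0r sub0r subr0 opprD addrC.
Qed.

Lemma jordan_lieP C B : 2%N \notin [pchar F] -> jordan_lie mul C B ->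
  [/\ (B <= C)%VS, {in B &, forall a b, mul a b = 0},
    {in B & C & B, forall a c b, mul (mul a c) b + mul (mul b c) a \in B}
    & {in B & C, forall a c, mul (mul a c) a \in B}].
Proof.
move=> two [[sBC BBC] BB0].
have BB a b : a \in B -> b \in B -> mul a b = 0.
  by move=> Ba Bb; apply/eqP; rewrite -memv0 -BB0 memv_spanop.
have BCB a c b : a \in B -> c \in C -> b \in B ->
    mul (mul a c) b + mul (mul b c) a \in B.
  move=> Ba Cc Bb; rewrite -memvN -commutator_commutator ?BB //.
  by apply: subvP BBC _ _; rewrite !memv_spanop.
(* Setting b = a gives 2 a c a in B, and 2 is invertible. *)
split=> // a c Ba Cc; have := BCB a c a Ba Cc Ba.
by rewrite -mulr2n -scaler_nat => /(memvZ 2%:R^-1); rewrite scalerA mulVf ?scale1r.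
Qed.

Lemma inner_of_jordan C B : (B <= C)%VS -> {in B &, forall a b, mul a b = 0} ->
  {in B & C & B, forall a c b, mul (mul a c) b \in B} -> inner mul C B.
Proof.
move=> sBC BB BCB; split=> //; apply/spanopP=> a z Ba BCz.
pose com : {bilinear A -> A -> A} := commutator mul.
suff: (spanop (commutator mul) B C <= linfun (com a) @^-1: B)%VS.
  by move/subvP/(_ z BCz); rewrite -memv_preim lfunE.
apply/spanopP=> b c Bb Cc; rewrite -memv_preim lfunE /= (commutator_commutator _ (BB a b Ba Bb) (BB b a Bb Ba)) memvN.
by apply: memvD; apply: BCB.
Qed.

Local Notation K := (unitization mulA).
Definition unit_emb : 'Hom(A, K) := linfun (@unitization_inj F A mul mulA).
Local Notation i := unit_emb.

Lemma unit_embM x y : i (mul x y) = i x * i y.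
Proof. by rewrite !lfunE; apply: unitization_injM. Qed.

Lemma unit_emb_inj : injective i.
Proof. by move=> x y; rewrite !lfunE => -[]. Qed.

Lemma mem_unit_emb U x : (i x \in (i @: U)%VS) = (x \in U).
Proof.
apply/idP/idP=> [/memv_imgP[y Uy /unit_emb_inj ->] // | Ux]; exact: memv_img.
Qed.

Lemma unit_emb_spanop U V : (i @: spanop mul U V = (i @: U) * (i @: V))%VS.
Proof.
apply/eqP; rewrite eqEsubv; apply/andP; split.
  suff sUV: (spanop mul U V <= i @^-1: ((i @: U) * (i @: V)))%VS.
    apply/subvP=> _ /memv_imgP[x /(subvP sUV) Wx ->].
    by rewrite memv_preim.
  apply/spanopP=> u v Uu Vv.
  by rewrite -memv_preim unit_embM memv_mul ?memv_img.
apply/prodvP=> _ _ /memv_imgP[u Uu ->] /memv_imgP[v Vv ->].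
by rewrite -unit_embM mem_unit_emb memv_spanop.
Qed.

Lemma unit_emb_powv U n : (i @: powv mul U n = (i @: U) ^+ n.+1)%VS.
Proof. by elim: n => [|n IHn]; rewrite ?expv1 //= unit_emb_spanop IHn -expvSr. Qed.

Lemma unit_emb_subalgebra C : subalgebra mul C -> ((i @: C) * (i @: C) <= i @: C)%VS.
Proof. by move=> CC; rewrite -unit_emb_spanop limgS. Qed.

(* The notation rad now refers to sesquilinear.rad, hence Defs.rad. *)
Lemma unit_emb_radical C : subalgebra mul C -> radical_ideal (i @: C) (i @: Defs.rad mul C).
Proof.
move=> CC; have [[_ CR RC] [n Rn0] maxR] := radP C mulA.
split.
- move=> _ _ /memv_imgP[x Cx ->] /memv_imgP[r Rr ->].
  by rewrite -unit_embM mem_unit_emb (spanopP _ _ _ _ CR).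
- move=> _ _ /memv_imgP[r Rr ->] /memv_imgP[x Cx ->].
  by rewrite -unit_embM mem_unit_emb (spanopP _ _ _ _ RC).
- move=> r Rr; exists n.+1; apply/eqP; rewrite -memv0.
  rewrite -(limg0 i) -Rn0 unit_emb_powv memvE -expv_line expvS // -memvE //.
move=> I m sIC CI IC Im0.
have IE : (i @: (i @^-1: I) = I)%VS.
  apply: lpreimK; apply: subv_trans sIC _; exact: limgS (subvf _).
rewrite -IE limgS //; apply: maxR.
  split.
  - by apply/subvP=> x Ix; rewrite -mem_unit_emb (subvP sIC) // memv_preim.
  - apply/spanopP=> c x Cc Ix; rewrite -memv_preim unit_embM (subvP CI) //.
    by rewrite memv_mul ?memv_img // memv_preim.
  - apply/spanopP=> x c Ix Cc; rewrite -memv_preim unit_embM (subvP IC) //.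
    by rewrite memv_mul ?memv_img // memv_preim.
exists m; apply/eqP; rewrite -subv0; apply/subvP=> x Ix.
by rewrite -mem_unit_emb limg0 -Im0 -IE -unit_emb_powv memv_img.
Qed.

(** The image of one linear map, rather than a span of products, so that each member has the form e
    c f with a single c. *)
Definition corner C e f : {vspace A} := (linfun (applyr mul f \o mul e) @: C)%VS.

Lemma cornerP C e f x :
  reflect (exists2 c, c \in C & x = mul (mul e c) f) (x \in corner C e f).
Proof.
by apply: (iffP memv_imgP) => -[c Cc ->]; exists c; rewrite ?lfunE.
Qed.

Lemma unit_emb_corner C e f : (i @: corner C e f = <[i e]> * (i @: C) * <[i f]>)%VS.
Proof.
apply/eqP; rewrite eqEsubv; apply/andP; split.
  apply/subvP=> _ /memv_imgP[_ /cornerP[c Cc ->] ->].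
  by rewrite !unit_embM !memv_mul ?memv_line ?memv_img.
apply/subvP=> _ /memv_cosetP[_ /vline_prodvP[_ /memv_imgP[c Cc ->] ->] ->].
by rewrite -!unit_embM mem_unit_emb; apply/cornerP; exists c.
Qed.

(** The square is zero since f e = 0, and (e c f) x (e d f) = e (c f x e d) f. *)
Lemma corner_regular C e f : subalgebra mul C -> e \in C -> f \in C -> mul f e = 0 ->
  regular_inner mul C (corner C e f).
Proof.
move=> CC Ce Cf fe; have CM := spanopP _ _ _ _ CC.
have sBC : (corner C e f <= C)%VS by apply/subvP=> _ /cornerP[c Cc ->]; rewrite !CM.
have BB : {in corner C e f &, forall a b, mul a b = 0}.
  move=> _ _ /cornerP[c Cc ->] /cornerP[d Cd ->].
  by rewrite !mulA -[mul (mul _ f) e]mulA fe linear0r !linear0l.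
have BCB : {in corner C e f & C & corner C e f, forall a c b, mul (mul a c) b \in corner C e f}.
  move=> _ x _ /cornerP[c Cc ->] Cx /cornerP[d Cd ->].
  apply/cornerP; exists (mul (mul (mul (mul c f) x) e) d); first by rewrite !CM.
  by rewrite !mulA.
split; first exact: inner_of_jordan.
  by apply/eqP; rewrite -subv0; apply/spanopP=> a b Ba Bb; rewrite BB ?mem0v.
apply/spanopP=> z b BCz Bb.
suff: (spanop mul (corner C e f) C <= linfun (applyr mul b) @^-1: corner C e f)%VS.
  by move/subvP/(_ z BCz); rewrite -memv_preim lfunE.
by apply/spanopP=> a c Ba Cc; rewrite -memv_preim lfunE /= BCB.
Qed.

Lemma linked_corner_exists C B : 2%N \notin [pchar F] -> subalgebra mul C ->
    jordan_lie mul C B ->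
  exists e f, [/\ linked_corner (i @: C) (i @: B) (i e) (i f), mul f e = 0
    & {in B, forall b, b - mul (mul e b) f \in Defs.rad mul C}].
Proof.
move=> two CC /(jordan_lieP two)[sBC BB BCB bCb].
have sBC' : (i @: B <= i @: C)%VS by apply: limgS.
have BB' : {in (i @: B)%VS &, forall a b, a * b = 0}.
  by move=> _ _ /memv_imgP[a Ba ->] /memv_imgP[b Bb ->]; rewrite -unit_embM BB ?linear0.
have BCB' : {in (i @: B)%VS & (i @: C)%VS & (i @: B)%VS,
    forall a c b, a * c * b + b * c * a \in (i @: B)%VS}.
  move=> _ _ _ /memv_imgP[a Ba ->] /memv_imgP[c Cc ->] /memv_imgP[b Bb ->].
  by rewrite -!unit_embM -linearD mem_unit_emb BCB.
have bCb' : {in (i @: B)%VS & (i @: C)%VS, forall a c, a * c * a \in (i @: B)%VS}.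
  move=> _ _ /memv_imgP[a Ba ->] /memv_imgP[c Cc ->].
  by rewrite -!unit_embM mem_unit_emb bCb.
have [e' [f' [ef Bef]]] := jordan_lie_linked_corner (unit_emb_subalgebra CC)
  (unit_emb_radical CC) sBC' BB' BCB' bCb'.
have /memv_imgP[e Ce eE] := lcl ef; have /memv_imgP[f Cf fE] := lcr ef.
rewrite {}eE {}fE in ef Bef; exists e, f; split=> //.
  apply: unit_emb_inj; rewrite unit_embM linear0.
  exact: corner_orthogonal ef.
move=> b Bb; have := Bef (i b); rewrite mem_unit_emb -!unit_embM -linearB mem_unit_emb.
exact.
Qed.

End Transfer.

(** * Passage from the corner e A' f to the corner e A f *)

Theorem corollary1p2 (F : closedFieldType) (A : vectType F)
    (mul : {bilinear A -> A -> A}) (A' B' : {vspace A}) :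
  associative mul ->
  2%N \notin [pchar F] -> 3%N \notin [pchar F] ->
  one_perfect mul fullv ->
  subalgebra mul A' ->
  jordan_lie mul A' B' -> bar_minimal mul A' B' ->
  (exists B : {vspace A},
     [/\ jordan_lie mul fullv B, bar_minimal mul fullv B & (B' <= B)%VS]) /\
  (exists B : {vspace A}, regular_inner mul fullv B /\ (B' <= B)%VS).
Proof.
move=> mulA two _ _ AA jlB' [_ minB'].
have fullA : subalgebra mul fullv by apply: subvf.
have [e [f [ef fe Bef]]] := linked_corner_exists mulA two AA jlB'.
have A'e : e \in A' by rewrite -(mem_unit_emb mulA) (lcl ef).
have A'f : f \in A' by rewrite -(mem_unit_emb mulA) (lcr ef).
have sB' : (corner mul A' e f <= B')%VS.
  apply/subvP=> _ /cornerP[c Cc ->].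
  by rewrite -(mem_unit_emb mulA) !unit_embM (lc_sub ef) ?memv_img.
(* The corner is an inner ideal inside B' with the same image, since each b in B' is congruent to e
   b f; bar-minimality forces equality. *)
have B'E : corner mul A' e f = B'.
  apply: minB' => //; first by have [] := corner_regular mulA AA A'e A'f fe.
  apply/bar_eqP/eqP; rewrite eqEsubv !subv_add !addvSr (subv_trans sB') ?addvSl //=.
  rewrite andbT; apply/subvP=> b Bb; rewrite -[b](subrK (mul (mul e b) f)) addrC.
  rewrite memv_add ?Bef //; apply/cornerP; exists b => //.
  by have [[[/subvP->]]] := jlB'.
pose B := corner mul fullv e f.
have sB'B : (B' <= B)%VS by rewrite -B'E limgS ?subvf.
have [innB BB BAB] := corner_regular mulA fullA (memvf e) (memvf f) fe.
split; exists B; split=> //; split=> // B1 inn1 sB1 /bar_eqP eqB1.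
have jl1 : jordan_lie mul fullv B1.
  split=> //; apply/eqP; rewrite -subv0 -BB; exact: spanopS.
have [e1 [f1 [ef1 _ B1ef1]]] := linked_corner_exists mulA two fullA jl1.
(* Linking persists from A' to A, because the spaces C f C and C e C only grow with C. *)
have efB : linked_corner (unit_emb mulA @: fullv) (unit_emb mulA @: B)
    (unit_emb mulA e) (unit_emb mulA f).
  have sA : (unit_emb mulA @: A' <= unit_emb mulA @: fullv)%VS by rewrite limgS ?subvf.
  case: ef => Ce Cf ee ff e_f f_e _; split=> //; try exact: subvP sA _ _.
  - by apply: subvP e_f; rewrite prodvS ?prodvSl.
  - by apply: subvP f_e; rewrite prodvS ?prodvSl.
  move=> _ /memv_imgP[c _ ->]; rewrite -!unit_embM mem_unit_emb.
  by apply/cornerP; exists c; rewrite ?memvf.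
apply/eqP; rewrite eqEsubv sB1 /=; apply/subvP=> _ /cornerP[c _ ->].
rewrite -(mem_unit_emb mulA) !unit_embM.
apply: (linked_corner_minimal (unit_emb_subalgebra mulA fullA)
  (unit_emb_radical mulA fullA) efB ef1); last by rewrite memv_img ?memvf.
- by rewrite -unit_emb_corner limgS.
- move=> _ /memv_imgP[d _ ->]; rewrite -!unit_embM -limgD mem_unit_emb eqB1.
  by apply: subvP (addvSl _ _) _ _; apply/cornerP; exists d; rewrite ?memvf.
- move=> _ /memv_imgP[b Bb ->]; rewrite -!unit_embM -linearB mem_unit_emb.
  exact: B1ef1.
Qed.
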